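(* Let $G$ be a finitely generated discrete group acting on a countable set $X$, and let $\mu$ be a probability measure on $G$. Suppose that $P_\mu$ is irreducible and lazy, in the sense that $P_\mu(x,x)\ge \frac12$ for all $x\in X$. If $(X,P_\mu)$ is Liouville, then for any two points $x,y\in X$, \[ \lim_{n\to\infty}\left\Vert \mu^{(n)}\cdot x-\mu^{(n)}\cdot y\right\Vert_1=0 . \]
   Context: The transition matrix on $X$ induced by a probability measure $\mu$ on $G$ is $P_\mu(x,y)=\sum_{g\in G}\mathbf{1}_{\{g\cdot x=y\}}\mu(g)$. For a probability measure $\nu$ on $G$ and $x\in X$, write $\nu\cdot x=P_\nu(x,\cdot)$, a probability measure on $X$. $\mu^{(n)}$ denotes the $n$-fold convolution power of $\mu$ on $G$, so that $\mu^{(n)}\cdot x=P_\mu^n(x,\cdot)$. For $f:X\to\mathbb{R}$, $\Vert f\Vert_1=\sum_{x\in X}|f(x)|$. $P_\mu$ is irreducible if for all $x,y\in X$ there is $n\ge 0$ with $P_\mu^n(x,y)>0$. A function $f:X\to\mathbb{R}$ is $P_\mu$-harmonic if $f(x)=\sum_{y\in X}f(y)P_\mu(x,y)$ for all $x\in X$, and $(X,P_\mu)$ is Liouville if all bounded $P_\mu$-harmonic functions are constant. *)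

(* Defs.v *)
From HB Require Import structures.
From mathcomp Require Import all_boot all_order all_algebra.
From mathcomp Require Import all_classical all_reals all_analysis.

Set Implicit Arguments.
Unset Strict Implicit.
Unset Printing Implicit Defensive.

Import Order.TTheory GRing.Theory Num.Theory.
Import numFieldNormedType.Exports.

Local Open Scope classical_set_scope.
Local Open Scope ring_scope.

Definition finitely_generated (G : groupType) : Prop :=
  exists S : seq G, forall H : {pred G},
    group_closed H -> {subset S <= H} -> forall g : G, g \in H.

Definition is_left_action (G : groupType) (X : Type) (act : G -> X -> X) : Prop :=
  (forall x, act 1%g x = x) /\
  (forall g h x, act (g * h)%g x = act g (act h x)).

(* A measure on a discrete set is given by its mass function. *)
Definition is_probability (R : realType) (T : choiceType) (mu : T -> R) : Prop :=
  (forall t, 0 <= mu t) /\ \esum_(t in [set: T]) (mu t)%:E = 1%E.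

(* In the definitions below, [fine] is applied to sums of nonnegative terms
   bounded by 1 whenever the arguments are probability measures or stochastic
   matrices. *)

(* [transition act nu x] is the measure nu.x, and [transition act nu] is the
   matrix P_nu. *)
Definition transition (R : realType) (G : groupType) (X : choiceType)
    (act : G -> X -> X) (nu : G -> R) (x y : X) : R :=
  fine (\esum_(g in [set: G]) (\1_[set h | act h x = y] g * nu g)%:E).

Definition convolution (R : realType) (G : groupType) (mu nu : G -> R) (g : G) : R :=
  fine (\esum_(h in [set: G]) (mu h * nu (h^-1 * g)%g)%:E).

Fixpoint conv_power (R : realType) (G : groupType) (mu : G -> R) (n : nat) : G -> R :=
  if n is m.+1 then convolution mu (conv_power mu m)
  else fun g => (g == 1%g)%:R.

Fixpoint kernel_power (R : realType) (X : choiceType) (P : X -> X -> R) (n : nat)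
    : X -> X -> R :=
  if n is m.+1 then
    fun x y => fine (\esum_(z in [set: X]) (P x z * kernel_power P m z y)%:E)
  else fun x y => (x == y)%:R.

Definition irreducible_kernel (R : realType) (X : choiceType) (P : X -> X -> R) : Prop :=
  forall x y, exists n, 0 < kernel_power P n x y.

Definition lazy_kernel (R : realType) (X : choiceType) (P : X -> X -> R) : Prop :=
  forall x, 2^-1 <= P x x.

(* [\esum] is only a sum for nonnegative terms; an absolutely convergent sum of
   terms of arbitrary sign is the difference of the sums of the positive and
   negative parts. *)
Definition harmonic_fun (R : realType) (X : choiceType) (P : X -> X -> R)
    (f : X -> R) : Prop :=
  forall x, let s := fun y => (f y * P x y)%:E in
    summable [set: X] s /\
    (f x)%:E = (\esum_(y in [set: X]) s^\+ y - \esum_(y in [set: X]) s^\- y)%E.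

Definition liouville (R : realType) (X : choiceType) (P : X -> X -> R) : Prop :=
  forall f : X -> R,
    (exists M : R, forall x, `|f x| <= M) -> harmonic_fun P f ->
    forall x y, f x = f y.

Definition l1_norm (R : realType) (X : choiceType) (f : X -> R) : \bar R :=
  \esum_(x in [set: X]) `|f x|%:E.

(* Main.v *)
Require Import Defs.
From HB Require Import structures.
From mathcomp Require Import all_boot all_order all_algebra.
From mathcomp Require Import all_classical all_reals all_analysis.
From mathcomp Require Import ring lra.

Set Implicit Arguments.
Unset Strict Implicit.
Unset Printing Implicit Defensive.

Import Order.TTheory GRing.Theory Num.Theory.
Import numFieldNormedType.Exports.
Local Open Scope classical_set_scope.
Local Open Scope ring_scope.

(** Write [P f x] for the mean of [f (g . x)] under [mu], and [p_n], [q_n] for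
    the measures mu^(n).x and mu^(n).y.  Two probabilities differ in l1 norm by
    twice the difference of the masses that they give to the set where the first
    dominates, so with [f_n] the indicator of [{q_n <= p_n}],
      || p_n - q_n ||_1 = 2 (P^n f_n x - P^n f_n y)
    ([l1_norm_probability], [markov_op_conv_power]).

    If this does not tend to 0, it stays away from 0 along some ultrafilter [U]
    finer than the filter of the tails of [nat].  The functions P^n f_n take
    their values in [[0, 1]], so the pointwise limits [u_k] of P^(n - k) f_n
    along [U] exist for every [k], and dominated convergence ([expect_cvg]) gives
    u_k = P u_(k+1): the sequence [u] is a bounded backward orbit of [P].

    Laziness forces a bounded backward orbit to be constant
    ([lazy_backward_orbit_cst]).  Let [c] be the supremum of
    d_k(x) = u_k(x) - u_(k+1)(x) over all [k] and [x], and suppose that [c > 0].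
    Since c - d_k = P (c - d_(k+1)) with c - d_(k+1) nonnegative, laziness gives
    c - d_(k+1)(x) <= 2 (c - d_k(x)) at every point.  Hence if d_k(x) is close
    enough to [c], then d_k(x), ..., d_(k+m-1)(x) are all at least c / 2, and
    u_k(x) - u_(k+m)(x) >= m c / 2, which is impossible for large [m] as [u] has
    values in [[0, 1]].  So [u] is nondecreasing in [k], and applying this to
    1 - u shows that it is constant.

    Thus u_0 = P u_0 is bounded and harmonic, hence constant by the Liouville
    property, and P^n f_n x - P^n f_n y tends to u_0(x) - u_0(y) = 0 along [U]
    ([liouville_ultra_cvg]), a contradiction. *)

(** * Sums over discrete types *)

Lemma esumZl (R : realType) (T : choiceType) (c : R) (a : T -> \bar R) :
  0 <= c -> (forall t, 0 <= a t)%E ->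
  (\esum_(t in [set: T]) (c%:E * a t) = c%:E * \esum_(t in [set: T]) a t)%E.
Proof.
(* The inequality [<=] for [c] and [c^-1] gives both directions. *)
have H (d : R) b : 0 <= d -> (forall t, 0 <= b t)%E ->
  (\esum_(t in [set: T]) (d%:E * b t) <= d%:E * \esum_(t in [set: T]) b t)%E.
  move=> d0 b0; apply: ge_ereal_sup => _ [F [finF _] <-].
  rewrite -ge0_mule_fsumr//; apply: lee_wpmul2l; first by rewrite lee_fin.
  by apply: esum_ge; exists F.
rewrite le_eqVlt => /orP[/eqP <-|c0] a0.
  by rewrite mul0e esum1// => t _; rewrite mul0e.
apply/eqP; rewrite eq_le H ?(ltW c0)//=.
have ci : 0 <= c^-1 by rewrite invr_ge0 ltW.
have := H _ (fun t => c%:E * a t)%E ci (fun t => mule_ge0 (ltW c0 : (0 <= c%:E)%E) (a0 t)).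
rewrite (eq_esum (b := a)); last first.
  by move=> t _; rewrite muleA -EFinM mulVf ?mul1e// gt_eqF.
move=> /(lee_wpmul2l (ltW c0 : (0 <= c%:E)%E)).
by rewrite (muleA c%:E) -EFinM mulfV ?gt_eqF// mul1e.
Qed.

Lemma exchange_esum (R : realType) (S T : choiceType) (a : S -> T -> \bar R) :
  (forall s t, 0 <= a s t)%E ->
  (\esum_(s in [set: S]) \esum_(t in [set: T]) a s t =
   \esum_(t in [set: T]) \esum_(s in [set: S]) a s t)%E.
Proof.
move=> a0; rewrite !esum_esum//.
apply: (@reindex_esum _ _ _ _ _ (fun k : T * S => (k.2, k.1))); split => //=.
- by move=> [x1 x2] [y1 y2] _ _ /= [-> ->].
- by move=> [s t] _; exists (t, s).
Qed.

Lemma indic_itv01 (R : realType) (T : Type) (A : set T) t : 0 <= (\1_A t : R) <= 1.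
Proof. by rewrite indicE; case: (t \in A); rewrite ?lexx ?ler01. Qed.

(** * Expectations under a discrete probability *)

(** The mean of [f] under the mass function [p].  Only nonnegative bounded [f] are
    considered, so that the sum of extended reals is the true one and is finite
    ([expectE]). *)
Definition expect (R : realType) (T : choiceType) (p f : T -> R) : R :=
  fine (\esum_(t in [set: T]) (p t * f t)%:E).

Section expect.
Context (R : realType) (T : choiceType).
Implicit Types p f g : T -> R.

Lemma expectE p f (M : R) : is_probability p -> (forall t, 0 <= f t <= M) ->
  (expect p f)%:E = \esum_(t in [set: T]) (p t * f t)%:E.
Proof.
move=> [p0 p1] fM; rewrite /expect fineK// ge0_fin_numE; last first.
  by apply: esum_ge0 => t _; rewrite lee_fin mulr_ge0//; case/andP: (fM t).
apply: (@le_lt_trans _ _ (\esum_(t in [set: T]) (`|M|%:E * (p t)%:E))%E).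
  apply: le_esum => t _; rewrite -EFinM lee_fin mulrC ler_wpM2r//.
  by case/andP: (fM t) => _ /le_trans; apply; exact: ler_norm.
by rewrite esumZl// p1 mule1 ltry.
Qed.

Lemma eq_expect p f g : f =1 g -> expect p f = expect p g.
Proof. by move=> fg; rewrite /expect; congr fine; apply: eq_esum => t _; rewrite fg. Qed.

Lemma expect_ge0 p f : is_probability p -> (forall t, 0 <= f t) -> 0 <= expect p f.
Proof.
move=> [p0 _] f0; apply: fine_ge0; apply: esum_ge0 => t _.
by rewrite lee_fin mulr_ge0.
Qed.

Lemma le_expect p f g (M : R) : is_probability p -> (forall t, 0 <= f t) ->
  (forall t, f t <= g t <= M) -> expect p f <= expect p g.
Proof.
move=> pp f0 fg; rewrite -lee_fin !(@expectE _ _ M)//.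
- by apply: le_esum => t _; rewrite lee_fin ler_wpM2l ?(pp.1 _)//; case/andP: (fg t).
- by move=> t; case/andP: (fg t) => /(le_trans (f0 t)) -> ->.
- by move=> t; case/andP: (fg t) => /le_trans h /h ->; rewrite f0.
Qed.

Lemma expectD p f g (M N : R) : is_probability p ->
  (forall t, 0 <= f t <= M) -> (forall t, 0 <= g t <= N) ->
  expect p (f \+ g) = expect p f + expect p g.
Proof.
move=> pp fM gN; apply: EFin_inj.
rewrite EFinD (@expectE _ f M)// (@expectE _ g N)// (@expectE _ _ (M + N))//.
  rewrite -esumD.
  - by apply: eq_esum => t _; rewrite -EFinD mulrDr.
  - by move=> t _; rewrite lee_fin mulr_ge0 ?(pp.1 _)//; case/andP: (fM t).
  - by move=> t _; rewrite lee_fin mulr_ge0 ?(pp.1 _)//; case/andP: (gN t).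
by move=> t /=; case/andP: (fM t) => ? ?; case/andP: (gN t) => ? ?; rewrite addr_ge0 ?lerD.
Qed.

Lemma expectZ p f (M c : R) : is_probability p -> 0 <= c ->
  (forall t, 0 <= f t <= M) -> expect p (fun t => c * f t) = c * expect p f.
Proof.
move=> pp c0 fM; apply: EFin_inj; rewrite EFinM (@expectE _ f M)// -esumZl//.
  rewrite (@expectE _ _ (c * M))//.
    by apply: eq_esum => t _; rewrite -EFinM mulrCA.
  by move=> t; case/andP: (fM t) => ? ?; rewrite mulr_ge0// ler_wpM2l.
by move=> t; rewrite lee_fin mulr_ge0 ?(pp.1 _)//; case/andP: (fM t).
Qed.

Lemma expect_cst p (c : R) : is_probability p -> 0 <= c -> expect p (fun=> c) = c.
Proof.
move=> pp c0; apply: EFin_inj; rewrite (@expectE _ _ c)//; last by move=> _; rewrite c0 lexx.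
rewrite (eq_esum (b := fun t => c%:E * (p t)%:E)%E); last first.
  by move=> t _; rewrite -EFinM mulrC.
by rewrite esumZl// ?pp.2 ?mule1// => t; rewrite lee_fin pp.1.
Qed.

Lemma expect_itv p f : is_probability p -> (forall t, 0 <= f t <= 1) ->
  0 <= expect p f <= 1.
Proof.
move=> pp f1; rewrite expect_ge0//=; last by move=> t; case/andP: (f1 t).
rewrite -[leRHS](@expect_cst p 1)//.
apply: (@le_expect _ _ _ 1) => // t; first by case/andP: (f1 t).
by case/andP: (f1 t) => _ ->; rewrite lexx.
Qed.

(** A finite set carries all but [e] of the mass of [p], uniformly in the
    integrand. *)
Lemma expect_tight p (e : R) : is_probability p -> 0 < e ->
  exists2 F : set T, finite_set F & forall f, (forall t, 0 <= f t <= 1) ->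
    \sum_(t \in F) p t * f t <= expect p f <= \sum_(t \in F) p t * f t + e.
Proof.
move=> pp e0.
have : ((1 - e)%:E < \esum_(t in [set: T]) (p t)%:E)%E.
  by rewrite pp.2 lte_fin ltrBlDr ltrDl.
move=> /ereal_sup_gt[_ [F [finF _] <-]] Fe.
exists F => // f f1.
have EF (h : T -> R) : (forall t, 0 <= h t) ->
    \esum_(t in F) (h t)%:E = (\sum_(t \in F) h t)%:E.
  by move=> h0; rewrite esum_fset//; [rewrite fsumEFin|move=> t _; rewrite lee_fin].
have pf0 t : 0 <= p t * f t by rewrite mulr_ge0 ?(pp.1 _)//; case/andP: (f1 t).
have tail : (\esum_(t in ~` F) (p t)%:E = (1 - \sum_(t \in F) p t)%:E)%E.
  have := pp.2; rewrite (esumID F); last by move=> t _; rewrite lee_fin pp.1.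
  by rewrite !setTI EF; [move=> h; rewrite EFinB -h addeAC subee ?add0e|exact: pp.1].
have split_f := expectE pp f1.
rewrite (esumID F) ?setTI ?EF// in split_f; last by move=> t _; rewrite lee_fin.
rewrite -!lee_fin split_f EFinD leeDl ?leeD2l//=.
  apply: (@le_trans _ _ (\esum_(t in ~` F) (p t)%:E)%E).
    apply: le_esum => t _; rewrite lee_fin ler_piMr ?(pp.1 _)//.
    by case/andP: (f1 t).
  rewrite tail lee_fin.
  by move: Fe; rewrite fsumEFin// lte_fin; lra.
by apply: esum_ge0 => t _; rewrite lee_fin.
Qed.

(** Dominated convergence along an arbitrary filter: uniform tightness replaces
    the countability of the index filter. *)
Lemma expect_cvg (I : Type) (U : set_system I) (UF : ProperFilter U)
    p (v : I -> T -> R) f :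
  is_probability p -> (forall i t, 0 <= v i t <= 1) -> (forall t, 0 <= f t <= 1) ->
  (forall t, v i t @[i --> U] --> f t) ->
  expect p (v i) @[i --> U] --> expect p f.
Proof.
move=> pp v1 f1 vf; apply/cvgrPdist_le => e e0.
have e2 : 0 < e / 2 by rewrite divr_gt0.
have [F finF HF] := expect_tight pp e2.
have cF : \sum_(t \in F) p t * v i t @[i --> U] --> \sum_(t \in F) p t * f t.
  under eq_cvg do rewrite fsbig_finite//.
  rewrite fsbig_finite//; apply: cvg_big => [|t _]; first exact: add_continuous.
  exact: cvgMr.
move/cvgrPdist_le : cF => /(_ _ e2); apply: filterS => i.
have /andP[a b] := HF _ f1; have /andP[c d] := HF _ (v1 i).
by rewrite !ler_distl; lra.
Qed.
End expect.

Lemma probability_le1 (R : realType) (T : choiceType) (p : T -> R) t :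
  is_probability p -> 0 <= p t <= 1.
Proof.
move=> [p0 p1]; rewrite p0/= -lee_fin -p1 (esumID [set t]) ?setTI; last first.
  by move=> s _; rewrite lee_fin.
rewrite esum_set1 ?lee_fin// leeDl//.
by apply: esum_ge0 => s _; rewrite lee_fin.
Qed.

Lemma expect_exchange (R : realType) (S T : choiceType) (p : S -> R) (q : T -> R)
    (F : S -> T -> R) :
  is_probability p -> is_probability q -> (forall s t, 0 <= F s t <= 1) ->
  expect p (fun s => expect q (F s)) = expect q (fun t => expect p (F^~ t)).
Proof.
move=> pp pq F1; apply: EFin_inj.
have F0 s t : 0 <= F s t by case/andP: (F1 s t).
rewrite (expectE (M := 1) pp); last by move=> s; exact: expect_itv.
rewrite (expectE (M := 1) pq); last by move=> t; exact: expect_itv.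
transitivity (\esum_(s in [set: S]) \esum_(t in [set: T]) (p s * (q t * F s t))%:E)%E.
  apply: eq_esum => s _; rewrite EFinM (expectE pq (F1 s)) -esumZl ?(pp.1 _)//.
  by move=> t; rewrite lee_fin mulr_ge0 ?(pq.1 _).
rewrite exchange_esum; last first.
  by move=> s t; rewrite lee_fin !mulr_ge0 ?(pp.1 _) ?(pq.1 _).
apply: eq_esum => t _; rewrite EFinM (expectE pp (fun s => F1 s t)) -esumZl ?(pq.1 _)//.
  by apply: eq_esum => s _; rewrite -EFinM mulrCA.
by move=> s; rewrite lee_fin mulr_ge0 ?(pp.1 _).
Qed.

Lemma is_probability_dirac (R : realType) (T : choiceType) (a : T) :
  is_probability (fun t => (t == a)%:R : R).
Proof.
split=> //; rewrite (eq_esum (b := fun t => if t \in [set a] then 1%E else 0%E)).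
  by rewrite -esum_mkcond esum_set1.
by move=> t _; rewrite classical_sets.in_set1; case: eqP.
Qed.

Lemma expect_dirac (R : realType) (T : choiceType) (a : T) (f : T -> R) :
  0 <= f a -> expect (fun t => (t == a)%:R : R) f = f a.
Proof.
move=> f0; rewrite /expect.
rewrite (eq_esum (b := fun t => if t \in [set a] then (f t)%:E else 0%E)).
  by rewrite -esum_mkcond esum_set1.
by move=> t _; rewrite classical_sets.in_set1; case: eqP; rewrite ?mul1r ?mul0r.
Qed.

(** * Convolution of measures on a group *)

Section convolution.
Context (R : realType) (G : groupType).
Implicit Types mu nu f : G -> R.

Lemma convolutionE mu nu g : is_probability mu -> is_probability nu ->
  (convolution mu nu g)%:E = \esum_(h in [set: G]) (mu h * nu (h^-1 * g)%g)%:E.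
Proof. by move=> pm pn; apply: (expectE (M := 1)) => // h; exact: probability_le1. Qed.

Lemma esum_convolution mu nu f :
  is_probability mu -> is_probability nu -> (forall g, 0 <= f g) ->
  \esum_(g in [set: G]) (convolution mu nu g * f g)%:E =
  \esum_(h in [set: G]) \esum_(k in [set: G]) (mu h * (nu k * f (h * k)%g))%:E.
Proof.
move=> pm pn f0.
transitivity (\esum_(g in [set: G]) \esum_(h in [set: G])
    (mu h * (nu (h^-1 * g)%g * f g))%:E)%E.
  apply: eq_esum => g _; rewrite mulrC EFinM convolutionE// -esumZl//.
    by apply: eq_esum => h _; rewrite -EFinM [LHS]/= mulrC -mulrA.
  by move=> h; rewrite lee_fin mulr_ge0 ?(pm.1 _) ?(pn.1 _).
rewrite exchange_esum; last first.
  by move=> g h; rewrite lee_fin !mulr_ge0 ?(pm.1 _) ?(pn.1 _).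
apply: eq_esum => h _.
rewrite [LHS](reindex_esum [set: G] [set: G] (fun k => (h * k)%g)).
  by apply: eq_esum => k _; rewrite mulKg.
split => //=; first by move=> a b _ _; exact: mulgI.
by move=> g _; exists (h^-1 * g)%g => //; rewrite mulVKg.
Qed.

Lemma is_probability_convolution mu nu :
  is_probability mu -> is_probability nu -> is_probability (convolution mu nu).
Proof.
move=> pm pn; split=> [g|].
  by apply: expect_ge0 => // h; exact: pn.1.
rewrite (eq_esum (b := fun g => (convolution mu nu g * 1)%:E)); last first.
  by move=> g _; rewrite mulr1.
rewrite esum_convolution// -[RHS]pm.2; apply: eq_esum => h _.
rewrite (eq_esum (b := fun k => (mu h)%:E * (nu k)%:E)%E); last first.
  by move=> k _; rewrite mulr1.
rewrite esumZl ?(pm.1 _) ?pn.2 ?mule1// => k; rewrite lee_fin; exact: pn.1.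
Qed.

Lemma expect_convolution mu nu f :
  is_probability mu -> is_probability nu -> (forall g, 0 <= f g <= 1) ->
  expect (convolution mu nu) f = expect mu (fun h => expect nu (fun k => f (h * k)%g)).
Proof.
move=> pm pn f1; apply: EFin_inj.
have f0 g : 0 <= f g by case/andP: (f1 g).
rewrite (expectE (M := 1) (is_probability_convolution pm pn))//.
rewrite (expectE (M := 1) pm); last by move=> h; exact: expect_itv.
rewrite esum_convolution//; apply: eq_esum => h _.
rewrite EFinM (expectE (M := 1) pn)// -esumZl ?(pm.1 _)//.
by move=> k; rewrite lee_fin mulr_ge0 ?(pn.1 _).
Qed.

Lemma is_probability_conv_power mu n :
  is_probability mu -> is_probability (conv_power mu n).
Proof.
move=> pm; elim: n => [|n IHn] /=; first exact: is_probability_dirac.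
exact: is_probability_convolution.
Qed.

End convolution.

(** * The Markov operator of a random walk on a G-space *)

Section action.
Context (R : realType) (G : groupType) (X : choiceType) (act : G -> X -> X).
Implicit Types (mu nu : G -> R) (f : X -> R).

Lemma transition_expect nu x y :
  transition act nu x y = expect nu (\1_[set h | act h x = y]).
Proof. by congr fine; apply: eq_esum => g _; rewrite mulrC. Qed.

Lemma esum_transition nu x f : is_probability nu -> (forall z, 0 <= f z) ->
  \esum_(y in [set: X]) (transition act nu x y * f y)%:E =
  \esum_(g in [set: G]) (nu g * f (act g x))%:E.
Proof.
move=> pn f0.
have i1 y g := indic_itv01 R [set h | act h x = y] g.
transitivity (\esum_(y in [set: X]) \esum_(g in [set: G])
    (f y * (nu g * \1_[set h | act h x = y] g))%:E)%E.
  apply: eq_esum => y _; rewrite transition_expect mulrC EFinM (expectE pn (i1 y)).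
  rewrite -esumZl// => g.
  by rewrite lee_fin mulr_ge0 ?(pn.1 _)//; case/andP: (i1 y g).
rewrite exchange_esum; last first.
  by move=> y g; rewrite lee_fin !mulr_ge0 ?(pn.1 _)//; case/andP: (i1 y g).
apply: eq_esum => g _.
rewrite (eq_esum (b := fun y => if y \in [set act g x] then (nu g * f y)%:E else 0%E)).
  by rewrite -esum_mkcond esum_set1// lee_fin mulr_ge0 ?(pn.1 _).
move=> y _; rewrite indicE classical_sets.in_set1.
case: (eqVneq y (act g x)) => [->|/eqP yg].
  by rewrite mem_set// mulr1 mulrC.
by rewrite memNset ?mulr0//= => /esym.
Qed.

Lemma is_probability_transition nu x :
  is_probability nu -> is_probability (transition act nu x).
Proof.
move=> pn; split=> [y|].
  by rewrite transition_expect; apply: expect_ge0 => // g; rewrite indicE.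
rewrite (eq_esum (b := fun y => (transition act nu x y * 1)%:E)); last first.
  by move=> y _; rewrite mulr1.
rewrite esum_transition// -[RHS]pn.2; apply: eq_esum => g _; by rewrite mulr1.
Qed.

(** The Markov operator of [transition act mu], written as a mean over the group
    instead of a sum over [X]; the two agree by [expect_transition]. *)
Definition markov_op mu f x := expect mu (fun g => f (act g x)).

Lemma expect_transition nu x f : is_probability nu -> (forall z, 0 <= f z) ->
  expect (transition act nu x) f = markov_op nu f x.
Proof. by move=> pn f0; rewrite /markov_op /expect esum_transition. Qed.

Lemma markov_op_itv mu f x : is_probability mu -> (forall z, 0 <= f z <= 1) ->
  0 <= markov_op mu f x <= 1.
Proof. by move=> pm f1; apply: expect_itv. Qed.

Lemma iter_markov_op_itv mu f n x : is_probability mu -> (forall z, 0 <= f z <= 1) ->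
  0 <= iter n (markov_op mu) f x <= 1.
Proof.
by move=> pm f1; elim: n x => [|n IHn] x //=; exact: markov_op_itv.
Qed.

(** The recursion of [conv_power] multiplies by [mu] on the left: the new factor is
    the last one to act on the point.  Exchanging the two means, it becomes the
    first application of the operator to the function. *)
Lemma markov_op_conv_power mu f n x : is_left_action act -> is_probability mu ->
  (forall z, 0 <= f z <= 1) ->
  markov_op (conv_power mu n) f x = iter n (markov_op mu) f x.
Proof.
move=> [act1 actM] pm; elim: n f x => [|n IHn] f x f1.
  rewrite /markov_op/= expect_dirac act1//.
  by case/andP: (f1 x).
have pn := is_probability_conv_power n pm.
rewrite iterSr -IHn; last by move=> z; exact: markov_op_itv.
rewrite /markov_op [conv_power _ _]/= expect_convolution// expect_exchange//.
by apply: eq_expect => k; apply: eq_expect => h; rewrite actM.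
Qed.

Lemma harmonic_markov_op mu f : is_probability mu -> (forall z, 0 <= f z <= 1) ->
  (forall x, f x = markov_op mu f x) -> harmonic_fun (transition act mu) f.
Proof.
move=> pm f1 fP x s.
have f0 z : 0 <= f z by case/andP: (f1 z).
have px := is_probability_transition x pm.
have s0 y : (0 <= s y)%E by rewrite lee_fin mulr_ge0 ?(px.1 _).
have sE : \esum_(y in [set: X]) s y = (f x)%:E.
  rewrite fP -expect_transition// (expectE px f1).
  by apply: eq_esum => y _; rewrite /s mulrC.
split.
  rewrite /summable (eq_esum (b := s)) ?sE ?ltry// => y _.
  by rewrite gee0_abs.
rewrite (eq_esum (b := s)) ?sE => [|y _]; last by rewrite (ge0_funeposE (D := [set: X])) ?in_setT.
by rewrite esum1 ?sube0// => y _; rewrite (ge0_funenegE (D := [set: X])) ?in_setT.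
Qed.

(** Keep only the mass that the walk leaves at its starting point. *)
Lemma lazy_markov_op mu f (M : R) x : is_probability mu ->
  lazy_kernel (transition act mu) -> (forall z, 0 <= f z <= M) ->
  f x / 2 <= markov_op mu f x.
Proof.
move=> pm lz fM; have fx0 : 0 <= f x by case/andP: (fM x).
apply: (@le_trans _ _ (f x * transition act mu x x)).
  by rewrite ler_wpM2l.
rewrite transition_expect -(expectZ (M := 1))//; last by move=> g; exact: indic_itv01.
apply: (le_expect (M := M)) => // g; first by rewrite mulr_ge0// indicE.
case/andP: (fM (act g x)) => f0 ->; rewrite andbT indicE.
have [|] := boolP (g \in _); last by rewrite mulr0.
by rewrite inE /= => ->; rewrite mulr1.
Qed.

End action.

(** * The l1 distance of two probabilities *)

Lemma l1_norm_probability (R : realType) (X : choiceType) (p q : X -> R) :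
  is_probability p -> is_probability q ->
  let A := [set z | q z <= p z] in
  l1_norm (fun z => p z - q z) = (2 * (expect p \1_A - expect q \1_A))%:E.
Proof.
move=> pp pq A.
have i1 := indic_itv01 R A.
have i0 z : 0 <= (\1_A z : R) by case/andP: (i1 z).
have p0 := pp.1; have q0 := pq.1.
pose Sp := \esum_(z in [set: X]) (p z * \1_A z)%:E.
pose Sq := \esum_(z in [set: X]) (q z * \1_A z)%:E.
(* Pointwise, |p - q| + 2 * 1_A * q + p = 2 * 1_A * p + q. *)
have : (l1_norm (fun z => (p z - q z)%R) + (2%:E * Sq + 1) = 2%:E * Sp + 1)%E.
  rewrite -{1}pp.2 -pq.2 -!esumZl//; first last.
  - by move=> z; rewrite lee_fin mulr_ge0.
  - by move=> z; rewrite lee_fin mulr_ge0.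
  rewrite -!esumD//; try by move=> z _; rewrite -?EFinM -?EFinD lee_fin ?addr_ge0 ?mulr_ge0.
  apply: eq_esum => z _; rewrite -!EFinM -!EFinD; congr EFin; rewrite indicE.
  have [|] := boolP (z \in A); rewrite ?inE /A /=.
    by move=> qp; rewrite ger0_norm ?subr_ge0//; ring.
  by rewrite notin_setE/= => /negP; rewrite -ltNge => pq'; rewrite ltr0_norm ?subr_lt0//; ring.
rewrite /Sp /Sq -!(expectE (M := 1))//.
by case: (l1_norm _) => [r| |] // [] h; congr EFin; move: h; lra.
Qed.

(** * Limits along an ultrafilter *)

Lemma ultra_cvg_itv01 (R : realType) (I : Type) (U : set_system I) (v : I -> R) :
  UltraFilter U -> (forall i, 0 <= v i <= 1) ->
  exists2 l : R, v @ U --> l & 0 <= l <= 1.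
Proof.
move=> UU v1.
have cpt : compact `[0, 1 : R] := @segment_compact R 0 1.
have [|l [/=]] := cpt (v @ U).
  by apply: (@filterE _ U) => i /=; rewrite in_itv/=.
rewrite in_itv/= => l1 cl; exists l => // V nV.
have [//|/= UnV] := in_ultra_setVsetC (v @^-1` V) UU.
by have [z []] := cl (~` V) V UnV nV.
Qed.

(** * Backward orbits of a lazy Markov operator *)

Section lazy_walk.
Context (R : realType) (G : groupType) (X : choiceType) (act : G -> X -> X)
  (mu : G -> R) (pm : is_probability mu) (lz : lazy_kernel (transition act mu)).

Local Notation P := (markov_op act mu).

(** A bounded backward orbit of a lazy Markov operator is nondecreasing: a nearly
    maximal decrease at a point would have to be repeated at the following times
    at that same point, for too long. *)
Lemma lazy_backward_orbit_le (u : nat -> X -> R) :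
  (forall k x, 0 <= u k x <= 1) -> (forall k x, u k x = P (u k.+1) x) ->
  forall k x, u k x <= u k.+1 x.
Proof.
move=> u1 uP k0 x0; rewrite leNgt; apply/negP => d0.
pose D := [set d | exists k x, d = u k x - u k.+1 x].
have D0 : D !=set0 by exists (u k0 x0 - u k0.+1 x0), k0, x0.
have supD : has_sup D.
  split=> //; exists 1 => _ [k [x ->]].
  by have /andP[? ?] := u1 k x; have /andP[? ?] := u1 k.+1 x; lra.
pose c := sup D.
have cub k x : u k x - u k.+1 x <= c by apply: sup_ubound; [exact: supD.2|exists k, x].
have c0 : 0 < c by apply: lt_le_trans (cub k0 x0); rewrite subr_gt0.
have c1 : c <= 1.
  apply: ge_sup => // _ [k [x ->]].
  by have /andP[? ?] := u1 k x; have /andP[? ?] := u1 k.+1 x; lra.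
have step k x : c - (u k.+1 x - u k.+2 x) <= 2 * (c - (u k x - u k.+1 x)).
  pose v z := c - (u k.+1 z - u k.+2 z).
  have v2 z : 0 <= v z <= 2.
    have /andP[? ?] := u1 k.+1 z; have /andP[? ?] := u1 k.+2 z.
    by have := cub k.+1 z; rewrite /v; lra.
  have := lazy_markov_op x pm lz v2.
  suff -> : P v x = c - (u k x - u k.+1 x) by rewrite /v; lra.
  have E : P v x + P (u k.+1) x = c + P (u k.+2) x.
    rewrite /markov_op -[in RHS](expect_cst pm (ltW c0)).
    rewrite -(expectD (M := 2) (N := 1) pm)// -(expectD (M := c) (N := 1) pm)//; last first.
      by move=> g; rewrite lexx ltW.
    by apply: eq_expect => g; rewrite /v/=; lra.
  by move: E; rewrite -!uP; lra.
have iterstep j k x : c - (u (k + j)%N x - u (k + j).+1 x) <= 2 ^+ j * (c - (u k x - u k.+1 x)).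
  elim: j => [|j IHj]; first by rewrite addn0 expr0 mul1r.
  rewrite addnS (le_trans (step _ _))// exprS -mulrA ler_pM2l//.
(* [m] steps of size at least c / 2 exceed 1; the defect [e] is small enough to be
   doubled [m] times and still be at most c / 2. *)
have [m mc] : exists m : nat, 4 <= m%:R * c.
  exists (Num.bound (4 / c)); rewrite -ler_pdivrMr//.
  by apply: ltW; apply: archi_boundP; rewrite divr_ge0// ltW.
pose e := c / 2 ^+ m.+1.
have e0 : 0 < e by rewrite divr_gt0// exprn_gt0.
have [_ [k [x ->]] ke] := sup_adherent e0 supD.
have big j : (j <= m)%N -> c / 2 <= u (k + j)%N x - u (k + j).+1 x.
  move=> jm; have := iterstep j k x.
  have : 2 ^+ j * (c - (u k x - u k.+1 x)) <= 2 ^+ m * e.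
    apply: ler_pM; [exact: exprn_ge0|by rewrite subr_ge0| |].
    - by rewrite ler_weXn2l// ler1n.
    - by move: ke; rewrite -/c; lra.
  have -> : 2 ^+ m * e = c / 2.
    by rewrite /e exprS; field; rewrite expf_neq0.
  lra.
have sumb j : (j <= m)%N -> j%:R * (c / 2) <= u k x - u (k + j)%N x.
  elim: j => [|j IHj] jm; first by rewrite mul0r addn0 subrr.
  have := IHj (ltnW jm); have := big j (ltnW jm).
  by rewrite addnS -(natr1 j) (mulrDl _ _ (c / 2)) mul1r; lra.
have := sumb m (leqnn m); have /andP[? ?] := u1 k x; have /andP[? ?] := u1 (k + m)%N x.
rewrite mulrA; lra.
Qed.

(** [1 - u] is again a bounded backward orbit. *)
Lemma lazy_backward_orbit_cst (u : nat -> X -> R) :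
  (forall k x, 0 <= u k x <= 1) -> (forall k x, u k x = P (u k.+1) x) ->
  forall k x, u k.+1 x = u k x.
Proof.
move=> u1 uP k x; apply/eqP; rewrite eq_le (lazy_backward_orbit_le u1 uP) andbT.
have u'1 j z : 0 <= 1 - u j z <= 1 by have /andP[? ?] := u1 j z; lra.
have u'P j z : 1 - u j z = P (fun w => 1 - u j.+1 w) z.
  have : P (fun w => 1 - u j.+1 w) z + P (u j.+1) z = 1.
    rewrite /markov_op -(expectD (M := 1) (N := 1) pm)//.
    rewrite -[RHS](expect_cst (c := 1) pm)//.
    by apply: eq_expect => g /=; rewrite subrK.
  by rewrite -uP; lra.
by have := lazy_backward_orbit_le u'1 u'P k x; lra.
Qed.

Lemma liouville_ultra_cvg (U : set_system nat) (f : nat -> X -> R) x y :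
  UltraFilter U -> \oo `<=` U -> liouville (transition act mu) ->
  (forall n z, 0 <= f n z <= 1) ->
  iter n P (f n) x - iter n P (f n) y @[n --> U] --> 0.
Proof.
move=> UU ooU hL f1.
have lim1 k z : exists l : R, iter (n - k) P (f n) z @[n --> U] --> l /\ 0 <= l <= 1.
  have [|l ? ?] := @ultra_cvg_itv01 R nat U (fun n => iter (n - k) P (f n) z) UU.
    by move=> n; exact: iter_markov_op_itv.
  by exists l.
have {lim1} [u uE] := choice (fun kz : nat * X => lim1 kz.1 kz.2).
(* [w k] is the limit along [U] of P^(n - k) (f n); the truncation of n - k only
   concerns the finitely many n < k. *)
pose w k z := u (k, z).
have w1 k z : 0 <= w k z <= 1 := (uE (k, z)).2.
have wP k z : w k z = P (w k.+1) z.
  apply: (@cvg_unique _ _ (iter (n - k) P (f n) z @[n --> U])) => //.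
  - exact: (uE (k, z)).1.
  - apply: cvg_trans (_ : P (iter (n - k.+1) P (f n)) z @[n --> U] --> _).
      apply: near_eq_cvg; apply: ooU; exists k.+1 => // n /= kn.
      by rewrite -iterS subnSK.
    apply: expect_cvg => //; first by move=> i g; exact: iter_markov_op_itv.
    by move=> g; exact: (uE (k.+1, act g z)).1.
have w0 : w 0%N x = w 0%N y.
  apply: hL.
    by exists 1 => z; have /andP[? ?] := w1 0%N z; rewrite ger0_norm.
  apply: harmonic_markov_op => // z.
  rewrite {1}wP; apply: eq_expect => g; exact: lazy_backward_orbit_cst.
have -> : (0 : R) = w 0%N x - w 0%N y by rewrite w0 subrr.
have cvg_w z : iter n P (f n) z @[n --> U] --> w 0%N z.
  by have := (uE (0%N, z)).1; under eq_cvg do rewrite subn0.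
exact: cvgB.
Qed.

End lazy_walk.

(** * Convergence of the l1 distance *)

Theorem lemma1 (R : realType) (G : groupType) (X : countType)
    (act : G -> X -> X) (mu : G -> R)
    (hG : finitely_generated G)
    (hact : is_left_action act)
    (hmu : is_probability mu)
    (hirr : irreducible_kernel (transition act mu))
    (hlazy : lazy_kernel (transition act mu))
    (hL : liouville (transition act mu))
    (x y : X) :
  l1_norm (fun z => transition act (conv_power mu n) x z
                    - transition act (conv_power mu n) y z)
    @[n --> \oo] --> 0%E.
Proof.
pose p n := transition act (conv_power mu n) x.
pose q n := transition act (conv_power mu n) y.
pose A n := [set z | q n z <= p n z].
pose P := markov_op act mu.
pose d n := iter n P (\1_(A n)) x - iter n P (\1_(A n)) y.
have i1 n := indic_itv01 R (A n).
have l1E n : l1_norm (fun z => p n z - q n z) = (2 * d n)%:E.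
  have pn := is_probability_conv_power n hmu.
  rewrite l1_norm_probability; [|exact: is_probability_transition..].
  have i0 z : 0 <= (\1_(A n) z : R) by case/andP: (i1 n z).
  rewrite -/(A n) !expect_transition// !markov_op_conv_power//; exact: i1.
under eq_cvg do rewrite l1E.
suff d0 : d n @[n --> \oo] --> 0.
  apply: cvg_EFin; first exact: nearW.
  by rewrite -(mulr0 2); apply: cvgMr.
apply/cvgrPdist_lt => e e0; apply: contrapT => nd.
(* The filter of tails of [nat] traced on [S] is proper since [S] is infinite. *)
pose S := [set n | e <= `|0 - d n|].
have PS : ProperFilter (within S \oo).
  apply: Build_ProperFilter_ex => B; rewrite /within/= => SB.
  apply: contrapT => B0; apply: nd; apply: filterS SB => n nB.
  by rewrite ltNge; apply/negP => /nB Bn; apply: B0; exists n.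
have [U [UU SU]] := ultraFilterLemma PS.
have ooU : \oo `<=` U by move=> B oB; apply: SU; apply: filterS oB.
have US : U S by apply: SU; exact: withinT.
have /cvgrPdist_lt/(_ _ e0) Ue :=
  liouville_ultra_cvg hmu hlazy x y UU ooU hL i1.
by have [n [/= Sn]] := filter_ex (filterI US Ue); rewrite ltNge Sn.
Qed.
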